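(* Let $\mathrm{Dis}$ be a bilinear disparity measure with weighting function $w_{\mathrm{Dis}}(x,a)=s_{\mathrm{Dis},a}\eta_a(x)+b_{\mathrm{Dis},a}$, and let $H_{\mathrm{Dis},a}(t)=\frac{1+t\,b_{\mathrm{Dis},a}}{2-t\,s_{\mathrm{Dis},a}}$. Suppose that for $a\in\{0,1\}$, both $\eta_a(X)$ and $w_{\mathrm{Dis}}(X,a)$ have probability density functions on $\mathcal X$. For $t\in\mathbb R$, let $\widetilde{\mathbb P}^{\,t}$ be the distribution of $(\widetilde X,\widetilde A,\widetilde Y)$ on $\mathcal X\times\{0,1\}^2$ satisfying that for all $(x,a,y)\in\mathcal X\times\{0,1\}^2$, $\widetilde{\mathbb P}^{\,t}_{\widetilde X\mid\widetilde A=a,\widetilde Y=y}(x)=\mathbb P_{X\mid A=a,Y=y}(x)$, and $$\widetilde p^{\,t}_{a,y}=\widetilde{\mathbb P}^{\,t}(\widetilde A=a,\widetilde Y=y)=c_a\big[(1-H_{\mathrm{Dis},a}(t))\,y+H_{\mathrm{Dis},a}(t)(1-y)\big]p_{a,y}.$$ Here $c_1>0$ and $c_0>0$ are such that $\widetilde p^{\,t}_{1,1}+\widetilde p^{\,t}_{1,0}+\widetilde p^{\,t}_{0,1}+\widetilde p^{\,t}_{0,0}=1$. Then the unconstrained Bayes-optimal classifier for $\widetilde{\mathbb P}^{\,t}$ is a $|D_{\mathrm{Dis}}(t)|$-fair Bayes-optimal classifier for $\mathbb P$. Thus, for a given $\delta\ge0$, any Bayes-optimal classifier for $\widetilde{\mathbb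 P}^{\,t_{\mathrm{Dis}}(\delta)}$ is a $\delta$-fair Bayes-optimal classifier for $\mathbb P$.
   Context: Let $(X,A,Y)\sim\mathbb P$ be a random triple with values in $\mathcal X\times\{0,1\}\times\{0,1\}$, where $X$ is the usual feature, $A$ the protected attribute and $Y$ the label. Let $p_{a,y}=\mathbb P(A=a,Y=y)$ and $\eta_a(x)=\mathbb P(Y=1\mid A=a,X=x)$; let $\mathbb P_{X,A}$ be the joint law of $(X,A)$, and $\mathbb P_{X\mid A=a,Y=y}$ the conditional distribution of $X$ given $A=a,Y=y$. Similarly, $\widetilde{\mathbb P}^{\,t}_{\widetilde X\mid\widetilde A=a,\widetilde Y=y}$ is the conditional distribution of $\widetilde X$ given $\widetilde A=a,\widetilde Y=y$ under $\widetilde{\mathbb P}^{\,t}$. $I(\cdot)$ is the indicator function. A (randomized) classifier is a measurable $f:\mathcal X\times\{0,1\}\to[0,1]$; $\mathcal F$ is the set of all of them. Its prediction satisfies $\widehat Y_f\mid X=x,A=a\sim\mathrm{Bernoulli}(f(x,a))$, conditionally independent of $Y$ given $(X,A)$. The misclassification error is $R(f)=\mathbb P(Y\ne\widehat Y_f)$. An (unconstrained) Bayes-optimal classifier for a distribution is any classifier minimizing the misclassification error under that distribution. A disparity measure $\mathrm{Dis}:\mathcal F\to[-1,1]$ is bilinear if $\mathrm{Dis}(f)=\int f(x,a)\,w_{\mathrm{Dis}}(x,a)\,d\mathbb P_{X,A}(x,a)$ for all $f\in\mathcal F$, where $w_{\mathrm{Dis}}(x,a)=s_{\mathrm{Dis},a}\eta_a(x)+b_{\mathrm{Dis},a}$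 with real numbers $s_{\mathrm{Dis},a},b_{\mathrm{Dis},a}$ depending only on $a$ (and $\mathbb P$). A $\delta$-fair Bayes-optimal classifier for $\mathbb P$ is any element of $\operatorname{argmin}_{f\in\mathcal F}\{R(f):|\mathrm{Dis}(f)|\le\delta\}$. For $t\in\mathbb R$, $f_{\mathrm{Dis},t}(x,a)=I\big(\eta_a(x)>\frac12+\frac t2w_{\mathrm{Dis}}(x,a)\big)$ and $D_{\mathrm{Dis}}(t)=\mathrm{Dis}(f_{\mathrm{Dis},t})$; for $\delta\ge0$, $t_{\mathrm{Dis}}(\delta)=\operatorname{argmin}_t\{|t|:|D_{\mathrm{Dis}}(t)|\le\delta\}$.
   Formalization: Both claims are stated only for t with 2 − t·s_{Dis,a} > 0 for a = 0,1, and the first claim (|D_Dis(t)|-fairness) also requires t·D_Dis(t) ≥ 0; without these conditions the statement fails. *)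

(* Defs.v *)
From HB Require Import structures.
From mathcomp Require Import all_boot all_order all_algebra.
From mathcomp Require Import all_classical all_reals all_analysis.

Set Implicit Arguments.
Unset Strict Implicit.
Unset Printing Implicit Defensive.

Import Order.TTheory GRing.Theory Num.Theory.
Import numFieldNormedType.Exports.

Local Open Scope classical_set_scope.
Local Open Scope ring_scope.

(* The law P of the triple (X, A, Y) is a probability measure on
   T * bool * bool, with {0,1} encoded as bool: for a point z, the feature is
   z.1.1, the protected attribute z.1.2, the label z.2, and z.1 = (X, A). *)

Section Model.
Context {d : measure_display} {T : measurableType d} {R : realType}.
Implicit Types (P Q : probability (T * bool * bool)%type R)
  (f : T * bool -> R) (eta : bool -> T -> R) (s b c : bool -> R)
  (Dis : (T * bool -> R) -> R).

Definition joint_XA P : set (T * bool) -> \bar R :=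
  pushforward P fst.

Definition cell (a y : bool) : set (T * bool * bool) :=
  [set z | z.1.2 = a /\ z.2 = y].

Definition cellp P (a y : bool) : R := fine (P (cell a y)).

(* P(X \in B | A = a, Y = y); only meaningful when cellp P a y != 0. *)
Definition condX P (a y : bool) (B : set T) : R :=
  fine (P ([set z | B z.1.1] `&` cell a y)) / cellp P a y.

(* eta a x is a version of P(Y = 1 | A = a, X = x). *)
Definition is_regression P eta : Prop :=
  [/\ (forall a, measurable_fun setT (eta a)),
      (forall a x, 0 <= eta a x <= 1) &
      forall B : set (T * bool), measurable B ->
        P [set z | B z.1 /\ z.2 = true] =
        (\int[joint_XA P]_(u in B) (eta u.2 u.1)%:E)%E].

Definition classifier : set (T * bool -> R) :=
  [set f : T * bool -> R | measurable_fun setT f /\ forall u, 0 <= f u <= 1].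

(* Law of (X, A, Y, Yhat_f): given (X, A, Y), the prediction is
   Bernoulli(f(X, A)); since this does not involve Y, Yhat_f is conditionally
   independent of Y given (X, A). *)
Definition prediction_law P f (E : set (T * bool * bool * bool)) : \bar R :=
  (\int[P]_z bernoulli_prob (f z.1) [set yhat | E (z, yhat)])%E.

Definition risk P f : R :=
  fine (prediction_law P f [set w | w.1.2 <> w.2]).

Definition bayes_optimal P f : Prop :=
  classifier f /\ forall g, classifier g -> risk P f <= risk P g.

Definition dis_weight eta s b (u : T * bool) : R :=
  s u.2 * eta u.2 u.1 + b u.2.

Definition bilinear_disparity P eta s b Dis : Prop :=
  forall f, classifier f ->
    -1 <= Dis f <= 1 /\
    (Dis f)%:E = (\int[joint_XA P]_u (f u * dis_weight eta s b u)%:E)%E.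

Definition fair_bayes_optimal P Dis (delta : R) f : Prop :=
  [/\ classifier f, `|Dis f| <= delta &
      forall g, classifier g -> `|Dis g| <= delta -> risk P f <= risk P g].

Definition f_Dis eta s b (t : R) : T * bool -> R :=
  fun u => if eta u.2 u.1 > 2^-1 + t / 2 * dis_weight eta s b u then 1 else 0.

Definition D_Dis eta s b Dis (t : R) : R := Dis (f_Dis eta s b t).

(* The set of minimizers defining t_Dis(delta). *)
Definition t_Dis eta s b Dis (delta : R) : set R :=
  [set t | `|D_Dis eta s b Dis t| <= delta /\
    forall t', `|D_Dis eta s b Dis t'| <= delta -> `|t| <= `|t'|].

Definition H_Dis s b (t : R) (a : bool) : R := (1 + t * b a) / (2 - t * s a).

Definition has_pdf P (Z : T * bool * bool -> R) : Prop :=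
  exists g : R -> R,
    [/\ measurable_fun setT g, (forall r, 0 <= g r) &
        forall B : set R, measurable B ->
          P (Z @^-1` B) = (\int[lebesgue_measure]_(r in B) (g r)%:E)%E].

(* Q is the reweighted law of P.  When the weight of (a, y) vanishes, the
   conditional law of X under Q is undefined and nothing is required of it. *)
Definition reweighted P s b (t : R) c Q : Prop :=
  (forall a y : bool,
     cellp Q a y =
       c a * ((1 - H_Dis s b t a) * y%:R + H_Dis s b t a * (1 - y%:R))
           * cellp P a y) /\
  (forall a y : bool, cellp Q a y != 0 ->
     forall B : set T, measurable B -> condX Q a y B = condX P a y B).

End Model.

(* Main.v *)
Require Import Defs.
From HB Require Import structures.
From mathcomp Require Import all_boot all_order all_algebra.
From mathcomp Require Import all_classical all_reals all_analysis.
From mathcomp Require Import measurable_realfun ring lra.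

Set Implicit Arguments.
Unset Strict Implicit.
Unset Printing Implicit Defensive.

Import Order.TTheory GRing.Theory Num.Theory.
Import numFieldNormedType.Exports.

Local Open Scope classical_set_scope.
Local Open Scope ring_scope.

(** The Lagrangian [R(g) + t Dis(g)] is, up to a constant, the integral of [g]
    against the margin [h = 1 + t w - 2 eta], so it is minimized by
    [f_t = I(h < 0)]. Under the reweighted law the risk is instead the integral
    of [g] against [c_a (H_a(t) - eta) = c_a / (2 - t s_a) * h], a positive
    multiple of the same margin; as [h = 0] only where [eta_a = H_a(t)], a null
    event, every Bayes-optimal classifier of the reweighted law equals [f_t]
    almost everywhere. It therefore minimizes the original risk among the [g]
    with [t Dis(g) <= t D(t)], which covers [|Dis(g)| <= |D(t)|] when
    [t D(t) >= 0]. If [t = t_Dis(delta)] is nonzero, then [|D(r t)| > delta] for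
    [0 <= r < 1]; since [D] is antitone and continuous at [t], letting [r]
    tend to [1] gives [t D(t) >= |t| delta], which covers [|Dis(g)| <= delta]. *)

(** * Bounded measurable functions under finite measures *)

Section BoundedMeasurable.
Context {d : measure_display} {X : measurableType d} {R : realType}.
Implicit Types F G : X -> R.

(** A class closed under ring operations and integrable for every finite measure, so that linearity
    of the integral needs no separate integrability proofs. *)
Definition bounded_measurable F :=
  measurable_fun setT F /\ exists M, forall x, `|F x| <= M.

Lemma bounded_measurable_cst (k : R) : bounded_measurable (fun=> k).
Proof. by split=> //; exists `|k|. Qed.

Lemma bounded_measurableD F G : bounded_measurable F -> bounded_measurable G ->
  bounded_measurable (fun x => F x + G x).
Proof.
move=> [mF [M FM]] [mG [N GN]]; split; first exact: measurable_funD.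
by exists (M + N) => x; rewrite (le_trans (ler_normD _ _))// lerD.
Qed.

Lemma bounded_measurableM F G : bounded_measurable F -> bounded_measurable G ->
  bounded_measurable (fun x => F x * G x).
Proof.
move=> [mF [M FM]] [mG [N GN]]; split; first exact: measurable_funM.
by exists (M * N) => x; rewrite normrM ler_pM.
Qed.

Lemma bounded_measurableN F : bounded_measurable F ->
  bounded_measurable (fun x => - F x).
Proof.
move=> [mF [M FM]]; split; first exact: measurableT_comp.
by exists M => x; rewrite normrN.
Qed.

Lemma bounded_measurable_integrable (mu : {finite_measure set X -> \bar R})
  (D : set X) F : measurable D -> bounded_measurable F ->
  mu.-integrable D (EFin \o F).
Proof.
move=> mD [mF [M FM]]; apply: measurable_bounded_integrable => //.
- by rewrite -ge0_fin_numE// fin_num_measure.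
- exact: measurable_funTS.
- exists M; split; first exact: num_real.
  by move=> N MN x _ /=; exact: le_trans (FM x) (ltW MN).
Qed.

Lemma bounded_RintegralD (mu : {finite_measure set X -> \bar R}) F G :
  bounded_measurable F -> bounded_measurable G ->
  \int[mu]_x (F x + G x) = \int[mu]_x F x + \int[mu]_x G x.
Proof. by move=> bF bG; rewrite RintegralD//; exact: bounded_measurable_integrable. Qed.

Lemma bounded_RintegralB (mu : {finite_measure set X -> \bar R}) F G :
  bounded_measurable F -> bounded_measurable G ->
  \int[mu]_x (F x - G x) = \int[mu]_x F x - \int[mu]_x G x.
Proof. by move=> bF bG; rewrite RintegralB//; exact: bounded_measurable_integrable. Qed.

Lemma bounded_RintegralZ (mu : {finite_measure set X -> \bar R}) (c : R) F :
  bounded_measurable F ->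
  \int[mu]_x (c * F x) = c * \int[mu]_x F x.
Proof. by move=> bF; rewrite RintegralZl//; exact: bounded_measurable_integrable. Qed.

Lemma ae_eq_bounded_Rintegral (mu : {finite_measure set X -> \bar R}) F G :
  bounded_measurable F -> bounded_measurable G ->
  {ae mu, forall x, F x = G x} -> \int[mu]_x F x = \int[mu]_x G x.
Proof.
move=> [mF _] [mG _] FG; congr fine.
apply: ae_eq_integral => //; [exact/measurable_EFinP|exact/measurable_EFinP|].
by apply: filterS FG => x -> _.
Qed.

(** The density formula makes [nu] absolutely continuous, so change of variables holds with its
    Radon-Nikodym derivative. That derivative has the same integrals as [g] over measurable sets,
    hence equals [g] almost everywhere. *)
Lemma integral_density (mu nu : {finite_measure set X -> \bar R})
    (g phi : X -> R) :
  measurable_fun setT g -> (forall x, 0 <= g x) ->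
  (forall A, measurable A -> nu A = (\int[mu]_(x in A) (g x)%:E)%E) ->
  measurable_fun setT phi -> (forall x, 0 <= phi x) ->
  (\int[nu]_x (phi x)%:E = \int[mu]_x (phi x * g x)%:E)%E.
Proof.
move=> mg g0 nuE mphi phi0.
have numu : nu `<< mu.
  apply/null_content_dominatesP => A mA muA0; rewrite nuE//.
  by apply: null_set_integral => //; apply/measurable_EFinP/measurable_funTS.
have -> : (\int[nu]_x (phi x)%:E = \int[mu]_x
    ((phi x)%:E * Radon_Nikodym_SigmaFinite.f nu mu x))%E.
  rewrite Radon_Nikodym_SigmaFinite.change_of_variables//.
  exact/measurable_EFinP.
under [RHS]eq_integral do rewrite EFinM.
have mf := measurable_int _ (Radon_Nikodym_SigmaFinite.f_integrable numu).
apply: ae_eq_integral => //.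
- by apply: emeasurable_funM => //; exact/measurable_EFinP.
- by apply: emeasurable_funM; exact/measurable_EFinP.
- apply: ae_eqe_mul2l; apply: integral_ae_eq => //.
  + exact: Radon_Nikodym_SigmaFinite.f_integrable.
  + exact/measurable_EFinP.
  + move=> A _ mA.
    by rewrite -(Radon_Nikodym_SigmaFinite.f_integral numu)// nuE.
Qed.

End BoundedMeasurable.

Lemma bounded_measurable_comp d d' (X : measurableType d)
    (Y : measurableType d') (R : realType) (p : Y -> X) (F : X -> R) :
  measurable_fun setT p -> bounded_measurable F ->
  bounded_measurable (fun y => F (p y)).
Proof.
move=> mp [mF [M FM]]; split; first exact: measurableT_comp.
by exists M => y.
Qed.

(** Packages an image measure as a finite measure, the form in which [integral_density] takes its
    measures. *)
Lemma finite_pushforward d d' (X : measurableType d) (Y : measurableType d')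
    (R : realType) (mu : {finite_measure set X -> \bar R}) (p : X -> Y) :
  measurable_fun setT p ->
  exists nu : {finite_measure set Y -> \bar R},
    nu = pushforward mu p :> (set Y -> \bar R).
Proof.
move=> mp.
have [m mE] : exists m : {measure set Y -> \bar R},
    m = pushforward mu p :> (set Y -> \bar R).
  by unshelve eexists (pushforward mu p : {measure set Y -> \bar R}).
have mT : (m setT < +oo)%E.
  by rewrite mE /pushforward preimage_setT ltey_eq fin_num_measure.
(* The restriction to [setT] only serves to obtain a finite-measure structure. *)
exists (mfrestr measurableT mT).
by rewrite -mE /=; apply/funext => A; rewrite /mfrestr /mrestr setIT.
Qed.

Ltac bounded_measurable_tac := repeat first
  [ solve [auto] | exact: bounded_measurable_cst | apply: bounded_measurableD
  | apply: bounded_measurableM | apply: bounded_measurableN ].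

(** * Laws compared cell by cell in attribute and label *)

Section Cells.
Context {d : measure_display} {T : measurableType d} {R : realType}.
Implicit Types (P Q : probability (T * bool * bool)%type R) (k : bool -> bool -> R)
  (f psi : T * bool -> R) (F : T * bool * bool -> R).

Lemma bounded_measurable_fst psi : bounded_measurable psi ->
  bounded_measurable (fun z : T * bool * bool => psi z.1).
Proof. exact: bounded_measurable_comp measurable_fst. Qed.

Lemma bounded_measurable_bool (g : bool -> R) : bounded_measurable g.
Proof.
split; first by move=> _ B mB.
exists (`|g true| + `|g false|) => -[]; first by rewrite lerDl.
by rewrite lerDr.
Qed.

Lemma bounded_measurable_attr (g : bool -> R) :
  bounded_measurable (fun u : T * bool => g u.2).
Proof.
exact: bounded_measurable_comp measurable_snd (bounded_measurable_bool g).
Qed.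

Lemma bounded_measurable_label (g : bool -> R) :
  bounded_measurable (fun z : T * bool * bool => g z.2).
Proof.
exact: bounded_measurable_comp measurable_snd (bounded_measurable_bool g).
Qed.

Lemma measurable_cell a y : measurable (cell a y : set (T * bool * bool)).
Proof.
rewrite [cell a y](_ : _ = (snd \o fst) @^-1` [set a] `&` snd @^-1` [set y])//.
apply: measurableI; rewrite -[X in measurable X]setTI.
  by apply: measurableT_comp.
exact: measurable_snd.
Qed.

(** Attribute and label are constant on a cell, so an event inside it is determined by its section
    in [T]. This gives the form of event on which [condX] is defined. *)
Lemma subset_cellE (A : set (T * bool * bool)) a y : A `<=` cell a y ->
  A = [set z | A (z.1.1, a, y)] `&` cell a y.
Proof.
move=> Acell; apply/seteqP; split => [[[x a'] y'] Az|[[x a'] y'] [/= Az [/= -> ->]]//].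
by split; [have [/= <- <-] := Acell _ Az|exact: Acell].
Qed.

Lemma measurable_cell_section (A : set (T * bool * bool)) a y :
  measurable A -> measurable [set x | A (x, a, y)].
Proof.
move=> mA; rewrite -[X in measurable X]setTI.
have m : measurable_fun setT (fun x : T => (x, a, y)).
  by do 2 apply: measurable_fun_pair => //.
exact: m.
Qed.

(* The weight [k a y] may be negative when the cell is [P]-null, so [Q] is not
   [k] times [P] as a measure. *)
Definition cell_scaled P Q k : Prop :=
  forall a y A, measurable A -> A `<=` cell a y ->
    fine (Q A) = k a y * fine (P A).

Lemma cell_scaled_refl P : cell_scaled P P (fun _ _ => 1).
Proof. by move=> a y A _ _; rewrite mul1r. Qed.

Lemma le_fine_cell P a y A : measurable A -> A `<=` cell a y ->
  0 <= fine (P A) <= cellp P a y.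
Proof.
move=> mA Acell; have mc := measurable_cell a y.
rewrite fine_ge0//= /cellp fine_le ?fin_num_measure//.
by rewrite le_measure ?inE.
Qed.

(** On a cell of positive [Q]-mass, multiply the equality of conditional laws by that mass. On a
    [Q]-null cell, either the weight is zero or the cell is also [P]-null, and both sides vanish. *)
Lemma reweighted_cell_scaled P Q (s b : bool -> R) t c :
  reweighted P s b t c Q ->
  cell_scaled P Q (fun a y =>
    c a * ((1 - H_Dis s b t a) * y%:R + H_Dis s b t a * (1 - y%:R))).
Proof.
move=> [QE condE] a y A mA Acell; have {QE} := QE a y; set k := c a * _ => QE.
have /andP[QA0 QA] := le_fine_cell Q mA Acell.
have /andP[PA0 PA] := le_fine_cell P mA Acell.
have [Q0|Q0] := eqVneq (cellp Q a y) 0.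
  have -> : fine (Q A) = 0 by apply/eqP; rewrite eq_le QA0 -Q0 QA.
  move/eqP: QE; rewrite Q0 eq_sym mulf_eq0 => /orP[/eqP ->|/eqP P0].
    by rewrite mul0r.
  suff -> : fine (P A) = 0 by rewrite mulr0.
  by apply/eqP; rewrite eq_le PA0 -P0 PA.
have P0 : cellp P a y != 0.
  by apply: contra_neq Q0 => P0; rewrite QE P0 mulr0.
have := condE a y Q0 _ (measurable_cell_section a y mA).
rewrite /condX -(subset_cellE Acell) => /(congr1 ( *%R^~ (cellp Q a y))).
by rewrite divfK// => ->; rewrite QE; field.
Qed.

Lemma Rintegral_cell_null P a y F : measurable_fun setT F ->
  fine (P (cell a y)) = 0 -> \int[P]_(z in cell a y) F z = 0.
Proof.
move=> mF P0.
have Pfin : P (cell a y) \is a fin_num.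
  exact: (fin_num_measure P _ (measurable_cell a y)).
rewrite /Rintegral null_set_integral//.
- exact: measurable_cell.
- exact/measurable_EFinP/measurable_funTS.
- by apply/eqP; rewrite -fine_eq0 ?P0 ?eqxx.
Qed.

Lemma Rintegral_cell_scaled P Q k a y F : cell_scaled P Q k ->
  bounded_measurable F -> (forall z, 0 <= F z) ->
  \int[Q]_(z in cell a y) F z = k a y * \int[P]_(z in cell a y) F z.
Proof.
move=> PQ bF F0; have mc : measurable (cell a y : set (T * bool * bool)).
  exact: measurable_cell.
have mF : measurable_fun setT F by case: bF.
(* A negative weight forces the cell to be null under both laws, since both masses are nonnegative.
   Otherwise [Q] coincides on the cell with a genuine scaled measure. *)
have [k0|k0] := leP 0 (k a y); last first.
  have QE := PQ a y _ mc (@subset_refl _ _).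
  have P0 : fine (P (cell a y)) = 0.
    apply/eqP; rewrite eq_le fine_ge0// andbT.
    by rewrite -(nmulr_rge0 _ k0) -QE fine_ge0.
  rewrite (Rintegral_cell_null mF P0) (Rintegral_cell_null mF) ?mulr0//.
  by rewrite QE P0 mulr0.
have QE A : measurable A -> A `<=` cell a y -> Q A = mscale (NngNum k0) P A.
  move=> mA Ac; have QA := fin_num_measure Q _ mA.
  have PA := fin_num_measure P _ mA.
  by rewrite -(fineK QA) (PQ a y _ mA Ac) EFinM (fineK PA).
rewrite /Rintegral (eq_measure_integral (mscale (NngNum k0) P) QE).
rewrite ge0_integral_mscale//=; last 2 first.
- exact/measurable_EFinP/measurable_funTS.
- by move=> z _; rewrite lee_fin.
have iF := bounded_measurable_integrable P mc bF.
by rewrite fineM//; exact: (integrable_fin_num mc iF).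
Qed.

Lemma Rintegral_cells P F : bounded_measurable F ->
  \int[P]_z F z = \int[P]_(z in cell true true) F z +
                  \int[P]_(z in cell true false) F z +
                  (\int[P]_(z in cell false true) F z +
                   \int[P]_(z in cell false false) F z).
Proof.
move=> bF; have mc a y := @measurable_cell a y.
have -> : [set: T * bool * bool] = (cell true true `|` cell true false) `|`
    (cell false true `|` cell false false).
  by apply/seteqP; split => // -[[x []] []] _; [left; left|left; right|right; left|right; right].
have splitU (A B : set (T * bool * bool)) : measurable A -> measurable B ->
    (forall z, A z -> B z -> False) -> \int[P]_(z in A `|` B) F z =
      \int[P]_(z in A) F z + \int[P]_(z in B) F z.
  move=> mA mB AB; apply: Rintegral_setU => //.
    by apply: bounded_measurable_integrable => //; exact: measurableU.
  by apply/disj_setPS => z [Az Bz]; exact: (AB z).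
rewrite (splitU _ _ (measurableU _ _ (mc _ _) (mc _ _)) (measurableU _ _ (mc _ _) (mc _ _))).
  rewrite (splitU _ _ (mc _ _) (mc _ _)); last first.
    by move=> z [_ e] [_]; rewrite e.
  rewrite (splitU _ _ (mc _ _) (mc _ _)) => //.
  by move=> z [_ e] [_]; rewrite e.
by move=> z [[e _]|[e _]] [[]|[]]; rewrite e.
Qed.

(** * The regression function in place of the label *)

Section Regression.
Variables (P : probability (T * bool * bool)%type R) (eta : bool -> T -> R).
Hypothesis eta_reg : is_regression P eta.

Lemma bounded_measurable_eta :
  bounded_measurable (fun u : T * bool => eta u.2 u.1).
Proof.
have [meta eta01 _] := eta_reg; split.
  rewrite [X in measurable_fun _ X](_ : _ =
      (fun u => if u.2 then eta true u.1 else eta false u.1)).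
    exact: measurable_fun_if_pair.
  by apply/funext => -[x []].
by exists 1 => -[x a] /=; have /andP[e0 e1] := eta01 a x; rewrite ger0_norm.
Qed.

Lemma eta_bounds a x : 0 <= eta a x <= 1.
Proof. by have [_] := eta_reg. Qed.

(** Tower property: both sides integrate [psi] against the law of [(X, A)] restricted to [Y = 1],
    whose density with respect to the law of [(X, A)] is [eta]. *)
Lemma Rintegral_label psi : bounded_measurable psi -> (forall u, 0 <= psi u) ->
  \int[P]_z (psi z.1 * z.2%:R) = \int[P]_z (psi z.1 * eta z.1.2 z.1.1).
Proof.
move=> bpsi psi0; have [mpsi _] := bpsi.
have [meta _] := bounded_measurable_eta.
have mY : measurable [set z : T * bool * bool | z.2 = true].
  have := @measurable_snd _ _ (T * bool)%type bool measurableT [set true].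
  by rewrite setTI; exact.
have labelE z : \1_[set z : T * bool * bool | z.2 = true] z = z.2%:R :> R.
  rewrite indicE; case: z => u [] /=; first by rewrite mem_set.
  by rewrite memNset.
(* [mu] is the law of [(X, A)]; [nu] is its part carried by the event [Y = 1]. *)
have [mu muE] := finite_pushforward P (@measurable_fst _ _ (T * bool)%type bool).
have [nu nuE] := finite_pushforward (mrestr P mY)
  (@measurable_fst _ _ (T * bool)%type bool).
have dens A : measurable A -> nu A = (\int[mu]_(u in A) (eta u.2 u.1)%:E)%E.
  move=> mA; have [_ _ regE] := eta_reg; rewrite muE -[RHS]regE//.
  by rewrite nuE.
congr fine.
transitivity (\int[mu]_u (psi u * eta u.2 u.1)%:E)%E; last first.
  rewrite muE (ge0_integral_pushforward measurable_fst) ?preimage_setT//.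
    by apply/measurable_EFinP; exact: measurable_funM.
  move=> u _; rewrite lee_fin mulr_ge0//.
  by have /andP[] := eta_bounds u.2 u.1.
rewrite -(integral_density meta _ dens mpsi psi0); last first.
  by move=> u; have /andP[] := eta_bounds u.2 u.1.
rewrite nuE (ge0_integral_pushforward measurable_fst) ?preimage_setT//; last 2 first.
- exact/measurable_EFinP.
- by move=> u _; rewrite lee_fin.
(* Second use of densities: [P] restricted to [Y = 1] has the label itself as density with respect
   to [P]. *)
apply/esym/(integral_density (mu := P) (nu := mrestr P mY)
  (g := fun z => z.2%:R) (phi := psi \o fst)) => //.
- by case: (bounded_measurable_label (fun y => y%:R)).
- by move=> A mA; under eq_integral do rewrite -labelE; rewrite integral_indic//= setIC.
- by case: (bounded_measurable_fst bpsi).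
- by move=> z /=.
Qed.

(** * The risk as an integral of a cost depending on [(X, A)] only *)

Lemma classifier_bounded_measurable f : classifier f -> bounded_measurable f.
Proof.
move=> [mf f01]; split => //; exists 1 => u.
by have /andP[f0 f1] := f01 u; rewrite ger0_norm.
Qed.

Lemma riskE Q f : classifier f ->
  risk Q f = \int[Q]_z (if z.2 then 1 - f z.1 else f z.1).
Proof.
move=> [_ f01]; congr fine; apply: eq_integral => -[u y] _ /=.
rewrite bernoulli_probE// !diracE.
case: y => /=.
  by rewrite memNset// mem_set// mule0 add0e mule1.
by rewrite mem_set// memNset// mule0 adde0 mule1.
Qed.

(** The conditional probability of error given [(X, A)], with the errors on label [y] weighted by
    [k a y]. *)
Definition cost k f (u : T * bool) : R :=
  k u.2 true * ((1 - f u) * eta u.2 u.1) +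
  k u.2 false * (f u * (1 - eta u.2 u.1)).

Lemma bounded_measurable_cost k f : classifier f ->
  bounded_measurable (cost k f).
Proof.
move=> cf; have bf := classifier_bounded_measurable cf.
have beta := bounded_measurable_eta.
have k1 := bounded_measurable_attr (k ^~ true).
have k0 := bounded_measurable_attr (k ^~ false).
rewrite /cost; bounded_measurable_tac.
Qed.

Lemma Rintegral_cell_true f a : classifier f ->
  \int[P]_(z in cell a true) (if z.2 then 1 - f z.1 else f z.1) =
  \int[P]_z ((z.1.2 == a)%:R * ((1 - f z.1) * eta z.1.2 z.1.1)).
Proof.
move=> cf; have bf := classifier_bounded_measurable cf.
have ba := bounded_measurable_attr (fun a' => (a' == a)%:R).
rewrite Rintegral_mkcond.
transitivity (\int[P]_z ((z.1.2 == a)%:R * (1 - f z.1) * z.2%:R)).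
  apply: eq_Rintegral => -[[x a'] y] _; rewrite patchE.
  case: y => /=; last by rewrite memNset ?mulr0// => -[].
  have [->|a'a] := eqVneq a' a; first by rewrite mem_set// mul1r mulr1.
  by rewrite memNset ?mul0r// => -[/= /eqP]; rewrite (negbTE a'a).
under [RHS]eq_Rintegral do rewrite mulrA.
apply: (Rintegral_label (psi := fun u => (u.2 == a)%:R * (1 - f u))).
  by bounded_measurable_tac.
move=> u; case: cf => _ /(_ u) /andP[_ f1].
by rewrite mulr_ge0// subr_ge0.
Qed.

Lemma Rintegral_cell_false f a : classifier f ->
  \int[P]_(z in cell a false) (if z.2 then 1 - f z.1 else f z.1) =
  \int[P]_z ((z.1.2 == a)%:R * (f z.1 * (1 - eta z.1.2 z.1.1))).
Proof.
move=> cf; have bf := classifier_bounded_measurable cf.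
have ba := bounded_measurable_attr (fun a' => (a' == a)%:R).
have bpsi : bounded_measurable (fun u : T * bool => (u.2 == a)%:R * f u).
  by bounded_measurable_tac.
have bpsi' := bounded_measurable_fst bpsi.
have beta := bounded_measurable_fst bounded_measurable_eta.
have by' := bounded_measurable_label (fun y => y%:R).
rewrite Rintegral_mkcond.
(* The indicator of label 0 is written as one minus the label, so that [Rintegral_label] applies to
   the second term. *)
transitivity (\int[P]_z ((z.1.2 == a)%:R * f z.1 - (z.1.2 == a)%:R * f z.1 * z.2%:R)).
  apply: eq_Rintegral => -[[x a'] y] _; rewrite patchE.
  case: y => /=; first by rewrite memNset ?mulr1 ?subrr// => -[].
  have [->|a'a] := eqVneq a' a; first by rewrite mem_set// mul1r mulr0 subr0.
  by rewrite memNset ?mul0r ?subr0// => -[/= /eqP]; rewrite (negbTE a'a).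
rewrite bounded_RintegralB; [|exact: bpsi'|by bounded_measurable_tac].
rewrite (Rintegral_label bpsi); last first.
  by move=> u; case: cf => _ /(_ u) /andP[f0 _]; rewrite mulr_ge0.
rewrite -bounded_RintegralB; [|exact: bpsi'|by bounded_measurable_tac].
by apply: eq_Rintegral => z _; ring.
Qed.

(** Split the error over the four cells, pass from [Q] to [P] on each, replace labels by [eta] and
    reassemble. Risks under both laws thereby become integrals against the same [P]. *)
Lemma risk_cost Q k f : cell_scaled P Q k -> classifier f ->
  risk Q f = \int[P]_z cost k f z.1.
Proof.
move=> PQ cf; have bf := classifier_bounded_measurable cf.
have bf' := bounded_measurable_fst bf.
have beta := bounded_measurable_fst bounded_measurable_eta.
have ba a := bounded_measurable_fst (bounded_measurable_attr (fun a' => (a' == a)%:R)).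
have bL : bounded_measurable
    (fun z : T * bool * bool => if z.2 then 1 - f z.1 else f z.1).
  rewrite [X in bounded_measurable X](_ : _ =
      fun z : T * bool * bool => z.2%:R * (1 - f z.1) + (1 - z.2%:R) * f z.1).
    have by' := bounded_measurable_label (fun y => y%:R).
    by bounded_measurable_tac.
  by apply/funext => -[u []] /=; ring.
have L0 (z : T * bool * bool) : 0 <= if z.2 then 1 - f z.1 else f z.1.
  case: cf => _ /(_ z.1) /andP[f0 f1].
  by case: ifP => // _; rewrite subr_ge0.
rewrite riskE// (Rintegral_cells Q bL) !(Rintegral_cell_scaled _ _ PQ bL L0).
rewrite !Rintegral_cell_true// !Rintegral_cell_false//.
rewrite -!bounded_RintegralZ; do ?by bounded_measurable_tac.
rewrite -!bounded_RintegralD; do ?by bounded_measurable_tac.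
apply: eq_Rintegral => -[[x []] y] _; rewrite /cost /=; ring.
Qed.

(** * The Lagrangian of risk and disparity *)

Lemma bounded_measurable_dis_weight (s b : bool -> R) :
  bounded_measurable (dis_weight eta s b).
Proof.
have beta := bounded_measurable_eta.
have bs := bounded_measurable_attr s; have bb := bounded_measurable_attr b.
by rewrite /dis_weight; bounded_measurable_tac.
Qed.

Variables (s b : bool -> R) (Dis : (T * bool -> R) -> R).
Hypothesis Dis_bilinear : bilinear_disparity P eta s b Dis.

Let w := dis_weight eta s b.

Definition margin (t : R) (u : T * bool) : R := 1 + t * w u - 2 * eta u.2 u.1.

Lemma f_DisE t u : f_Dis eta s b t u = if margin t u < 0 then 1 else 0.
Proof.
rewrite /f_Dis /margin -/w; set e := eta _ _.
suff -> : (2^-1 + t / 2 * w u < e) = (1 + t * w u - 2 * e < 0) by [].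
by apply/idP/idP; lra.
Qed.

Lemma f_Dis_classifier t : classifier (f_Dis eta s b t).
Proof.
split; last by move=> u; rewrite /f_Dis; case: ifP; rewrite ?lexx ?ler01.
apply: measurable_fun_ifT => //; apply: measurable_fun_ltr.
  have [mw _] := bounded_measurable_dis_weight s b.
  by apply: measurable_funD => //; apply: measurable_funM.
by case: bounded_measurable_eta.
Qed.

Lemma DisE f : classifier f -> Dis f = \int[P]_z (f z.1 * w z.1).
Proof.
move=> cf; have [_ DE] := Dis_bilinear cf.
have bf := classifier_bounded_measurable cf.
have bw := bounded_measurable_dis_weight s b.
have bfw : bounded_measurable (fun u => f u * w u).
  by bounded_measurable_tac.
have ifw : P.-integrable setT (EFin \o (fun z => f z.1 * w z.1)).
  apply: bounded_measurable_integrable => //.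
  exact: (bounded_measurable_fst bfw).
apply: EFin_inj; rewrite DE /joint_XA (integral_pushforward measurable_fst)//.
- rewrite preimage_setT /Rintegral fineK//.
  exact: integrable_fin_num ifw.
- by case: bfw => mfw _; exact/measurable_EFinP.
Qed.

Lemma f_Dis_lagrangian t g : classifier g ->
  risk P (f_Dis eta s b t) + t * D_Dis eta s b Dis t <= risk P g + t * Dis g.
Proof.
move=> cg.
(* The classifier enters only through its product with the margin, so the minimization is pointwise
   over values in [[0, 1]]. *)
have lagE f : classifier f -> risk P f + t * Dis f =
    \int[P]_z (eta z.1.2 z.1.1 + f z.1 * margin t z.1).
  move=> cf; rewrite (risk_cost (cell_scaled_refl P) cf) (DisE cf).
  have bc := bounded_measurable_fst (bounded_measurable_cost (fun _ _ => 1) cf).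
  have bf := bounded_measurable_fst (classifier_bounded_measurable cf).
  have bw := bounded_measurable_fst (bounded_measurable_dis_weight s b).
  rewrite -bounded_RintegralZ; last by bounded_measurable_tac.
  rewrite -bounded_RintegralD; [|exact: bc|by bounded_measurable_tac].
  by apply: eq_Rintegral => z _; rewrite /cost /margin; ring.
have bmargin : bounded_measurable (margin t).
  have bw := bounded_measurable_dis_weight s b.
  have beta := bounded_measurable_eta.
  by rewrite /margin; bounded_measurable_tac.
have int f : classifier f -> P.-integrable setT
    (EFin \o (fun z => eta z.1.2 z.1.1 + f z.1 * margin t z.1)).
  move=> cf; apply: bounded_measurable_integrable => //.
  have bf := classifier_bounded_measurable cf.
  have beta := bounded_measurable_eta.
  apply: (@bounded_measurable_fst (fun u => eta u.2 u.1 + f u * margin t u)).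
  by bounded_measurable_tac.
rewrite (lagE _ cg) (lagE _ (f_Dis_classifier t)); apply: le_Rintegral => //.
- exact: int (f_Dis_classifier t).
- exact: int cg.
move=> z _; rewrite lerD2l f_DisE.
case: cg => _ /(_ z.1) /andP[g0 g1].
by case: ltP => m0; rewrite ?mul1r ?mul0r; nra.
Qed.

(** Add the optimality of [f_t] against [f_t'] at multiplier [t] to that of [f_t'] against [f_t] at
    multiplier [t']; the risks cancel. *)
Lemma D_Dis_antitone t t' :
  (t - t') * (D_Dis eta s b Dis t - D_Dis eta s b Dis t') <= 0.
Proof.
have := f_Dis_lagrangian t (f_Dis_classifier t').
have := f_Dis_lagrangian t' (f_Dis_classifier t).
by rewrite /D_Dis; lra.
Qed.

(** * The zero set of the margin and the limit of the disparity at [t] *)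

Hypothesis eta_pdf : forall a : bool, has_pdf P (fun z => eta a z.1.1).
Variable t : R.
Hypothesis t_dom : forall a : bool, 0 < 2 - t * s a.

(** The margin factors as [(2 - t s_a) (H_a(t) - eta_a)], with a positive first factor. *)
Lemma margin_eq0 u : margin t u = 0 -> eta u.2 u.1 = H_Dis s b t u.2.
Proof.
have := t_dom u.2; rewrite /margin /w /dis_weight /H_Dis => s0 m0.
by apply: (canRL (mulfK (lt0r_neq0 s0))); lra.
Qed.

(** A law with a density has no atoms, so [eta_a(X)] almost surely avoids the single value [H_a(t)],
    for both [a] at once. *)
Lemma margin_neq0_ae : {ae P, forall z, margin t z.1 != 0}.
Proof.
have etaH a : {ae P, forall z, eta a z.1.1 != H_Dis s b t a}.
  have [g [_ _ gE]] := eta_pdf a.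
  have [meta _ _] := eta_reg.
  exists ((fun z : T * bool * bool => eta a z.1.1) @^-1` [set H_Dis s b t a]).
  split.
  - rewrite -[X in measurable X]setTI.
    have m : measurable_fun setT (fun z : T * bool * bool => eta a z.1.1).
      by do 2 apply: measurableT_comp => //.
    exact: m.
  - by rewrite gE// integral_set1.
  - by move=> z /= /negP; rewrite negbK => /eqP.
have := etaH true; have := etaH false; apply: filterS2 => -[[x []] y] /= Ef Et.
  by apply: contraNneq Et => /margin_eq0 /= ->.
by apply: contraNneq Ef => /margin_eq0 /= ->.
Qed.

(** Dominated convergence with bound [|w|]. The factors [1 - 1/(n+1)] lie in [[0, 1)], so the
    sequence approaches [t] from the side of 0, where minimality of [|t|] gives information. *)
Lemma D_Dis_cvg :
  D_Dis eta s b Dis (t * (1 - n.+1%:R^-1)) @[n --> \oo] --> D_Dis eta s b Dis t.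
Proof.
pose tn (n : nat) := t * (1 - n.+1%:R^-1).
have tn_cvg : tn n @[n --> \oo] --> t.
  rewrite -[X in _ --> X]mulr1 -[X in _ * X]subr0.
  by apply: cvgMr; apply: cvgB; [exact: cvg_cst|exact: cvg_harmonic].
have bw := bounded_measurable_fst (bounded_measurable_dis_weight s b).
have bf t' := bounded_measurable_fst
  (classifier_bounded_measurable (f_Dis_classifier t')).
have bfw t' : bounded_measurable (fun z : T * bool * bool =>
    f_Dis eta s b t' z.1 * w z.1).
  by have := bf t' => ?; bounded_measurable_tac.
have mfw t' : measurable_fun setT (fun z : T * bool * bool =>
    (f_Dis eta s b t' z.1 * w z.1)%:E).
  by apply/measurable_EFinP; case: (bfw t').
have DE t' : (D_Dis eta s b Dis t')%:E =
    (\int[P]_z (f_Dis eta s b t' z.1 * w z.1)%:E)%E.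
  rewrite /D_Dis (DisE (f_Dis_classifier t')) /Rintegral fineK//.
  apply: integrable_fin_num => //.
  exact: (bounded_measurable_integrable P measurableT (bfw t')).
suff : (D_Dis eta s b Dis (tn n))%:E @[n --> \oo] --> (D_Dis eta s b Dis t)%:E.
  by move=> /fine_cvgP[_].
rewrite DE; under eq_cvg do rewrite DE.
have cvg_ae : {ae P, forall z, setT z ->
    (f_Dis eta s b (tn n) z.1 * w z.1)%:E @[n --> \oo] -->
    (f_Dis eta s b t z.1 * w z.1)%:E}.
  apply: filterS margin_neq0_ae => z mz _.
  apply: cvg_EFin; first exact: nearW.
  apply: cvgM; last exact: cvg_cst.
  have margin_cvg : margin (tn n) z.1 @[n --> \oo] --> margin t z.1.
    apply: cvgB; last exact: cvg_cst.
    apply: cvgD; first exact: cvg_cst.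
    by apply: cvgM; [exact: tn_cvg|exact: cvg_cst].
  (* Where the margin at [t] is nonzero, the margins at [tn n] eventually share its sign, so the
     thresholded values are eventually constant. *)
  apply: cvg_near_cst; have [m0|m0] := ltP (margin t z.1) 0.
    have mlt : \forall n \near \oo, margin (tn n) z.1 < 0.
      exact: (cvgr_lt _ margin_cvg _ m0).
    apply: filterS mlt => n mn.
    by rewrite !f_DisE m0 mn.
  have {}m0 : 0 < margin t z.1 by rewrite lt_neqAle eq_sym mz.
  have mgt : \forall n \near \oo, 0 < margin (tn n) z.1.
    exact: (cvgr_gt _ margin_cvg _ m0).
  apply: filterS mgt => n mn.
  by rewrite !f_DisE !ltNge (ltW mn) (ltW m0).
have iw : P.-integrable setT (EFin \o (fun z => `|w z.1|)).
  apply: bounded_measurable_integrable => //.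
  case: bw => mw [M wM]; split; first exact: measurableT_comp.
  by exists M => z; rewrite normr_id.
have dom : {ae P, forall z n, setT z ->
    (`|(f_Dis eta s b (tn n) z.1 * w z.1)%:E| <= `|w z.1|%:E)%E}.
  apply: aeW => z n _; rewrite abse_EFin lee_fin normrM ler_piMl//.
  have [_ /(_ z.1) /andP[f0 f1]] := f_Dis_classifier (tn n).
  by rewrite ger0_norm.
have [_ _] := dominated_convergence measurableT (fun n => mfw (tn n)) (mfw t)
  cvg_ae iw dom.
exact.
Qed.

Lemma t_Dis_dominates delta g : t_Dis eta s b Dis delta t ->
  `|Dis g| <= delta -> t * Dis g <= t * D_Dis eta s b Dis t.
Proof.
move=> [Dt tmin] gdelta.
suff tD : `|t| * delta <= t * D_Dis eta s b Dis t.
  apply: le_trans tD; apply: le_trans (ler_norm _) _.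
  by rewrite normrM ler_wpM2l.
have [->|t0] := eqVneq t 0; first by rewrite normr0 !mul0r.
have cv : t * D_Dis eta s b Dis (t * (1 - n.+1%:R^-1)) @[n --> \oo] -->
    t * D_Dis eta s b Dis t.
  by apply: cvgMr; exact: D_Dis_cvg.
apply: (cvgr_to_ge cv); apply: nearW => n.
set r := n.+1%:R^-1; set t' := t * (1 - r).
have r0 : 0 < r by rewrite invr_gt0.
have r1 : r <= 1 by rewrite invf_le1 ?ler1n.
(* Here [|t'| = (1 - r) |t| < |t|], so [t'] cannot be feasible. *)
have Dt' : delta < `|D_Dis eta s b Dis t'|.
  rewrite ltNge; apply/negP => /tmin; apply/negP; rewrite -ltNge normrM.
  have : 0 < `|t| by rewrite normr_gt0.
  by rewrite [`|1 - r|]ger0_norm ?subr_ge0//; nra.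
have anti : t * (D_Dis eta s b Dis t - D_Dis eta s b Dis t') <= 0.
  have := D_Dis_antitone t t'.
  have -> : t - t' = r * t by rewrite /t'; ring.
  by rewrite -mulrA pmulr_rle0.
have : `|t| * delta < `|t * D_Dis eta s b Dis t'|.
  by rewrite normrM ltr_pM2l ?normr_gt0.
have : `|t * D_Dis eta s b Dis t| <= `|t| * delta by rewrite normrM ler_wpM2l.
(* The alternative [t D(t') < - |t| delta] is excluded, because
   [t D(t') >= t D(t) >= - |t| delta]. *)
rewrite ler_norml lter_normr => /andP[lo _] /orP[]; lra.
Qed.

(** * Bayes-optimal classifiers of the reweighted law *)

Variables (c : bool -> R) (Q : probability (T * bool * bool)%type R).
Hypothesis c_gt0 : forall a, 0 < c a.
Hypothesis Q_reweighted : reweighted P s b t c Q.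

(** The excess cost [G] of [f] over [f_t] is pointwise nonnegative, and optimality makes its
    integral nonpositive. Hence it vanishes almost everywhere, which forces equality wherever the
    margin is nonzero. *)
Lemma bayes_optimal_ae f : bayes_optimal Q f ->
  {ae P, forall z, f z.1 = f_Dis eta s b t z.1}.
Proof.
move=> [cf fopt]; have cft := f_Dis_classifier t.
have PQ := reweighted_cell_scaled Q_reweighted; set k := (fun _ _ => _) in PQ.
pose G (z : T * bool * bool) := cost k f z.1 - cost k (f_Dis eta s b t) z.1.
(* With weights [c_a (1 - H_a)] on label 1 and [c_a H_a] on label 0, the coefficient of [f] in the
   cost is [c_a (H_a - eta_a)]. *)
have GE z : G z = c z.1.2 / (2 - t * s z.1.2) *
    ((f z.1 - f_Dis eta s b t z.1) * margin t z.1).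
  rewrite /G /cost /k /H_Dis /margin /w /dis_weight.
  by have := lt0r_neq0 (t_dom z.1.2); rewrite !mulr1n !mulr0n => s0; field.
have v0 a : 0 < c a / (2 - t * s a) by rewrite divr_gt0.
have G0 z : 0 <= G z.
  rewrite GE (pmulr_rge0 _ (v0 _)) f_DisE.
  have [_ /(_ z.1) /andP[f0 f1]] := cf.
  by case: ltP => m0; nra.
have bcost g : classifier g -> bounded_measurable (fun z : T * bool * bool => cost k g z.1).
  by move=> cg; apply: bounded_measurable_fst; exact: bounded_measurable_cost.
have bG : bounded_measurable G.
  by have := bcost _ cf; have := bcost _ cft => *; rewrite /G; bounded_measurable_tac.
have intG : \int[P]_z G z = 0.
  apply/eqP; rewrite eq_le Rintegral_ge0// andbT.
  rewrite /G bounded_RintegralB; [|exact: bcost..].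
  by rewrite -!(risk_cost PQ)// subr_le0 fopt.
have mG : measurable_fun setT (EFin \o G) by apply/measurable_EFinP; case: bG.
have : (\int[P]_z `|(EFin \o G) z| = 0)%E.
  under eq_integral do rewrite /= ger0_norm//.
  have iG := bounded_measurable_integrable P measurableT bG.
  by rewrite -[LHS](fineK (integrable_fin_num measurableT iG)); congr EFin.
move=> /(ae_eq_integral_abs P measurableT mG).1; apply: filterS2 margin_neq0_ae.
move=> z mz /(_ Logic.I) /= [] /eqP.
by rewrite GE mulf_eq0 (gt_eqF (v0 _)) /= mulf_eq0 (negbTE mz) orbF subr_eq0 => /eqP.
Qed.

(** Disparity and risk are integrals under [P], so both are inherited from [f_t] by
    almost-everywhere equality. The Lagrangian inequality then compares risks once [t Dis(g)] is at
    most [t D(t)]. *)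
Lemma bayes_optimal_constrained f : bayes_optimal Q f ->
  Dis f = D_Dis eta s b Dis t /\
  forall g, classifier g -> t * Dis g <= t * D_Dis eta s b Dis t ->
    risk P f <= risk P g.
Proof.
move=> bf; have fE := bayes_optimal_ae bf; have [cf _] := bf.
have cft := f_Dis_classifier t.
have bf' := bounded_measurable_fst (classifier_bounded_measurable cf).
have bft := bounded_measurable_fst (classifier_bounded_measurable cft).
have bw := bounded_measurable_fst (bounded_measurable_dis_weight s b).
have eqD : Dis f = D_Dis eta s b Dis t.
  rewrite /D_Dis !DisE//; apply: ae_eq_bounded_Rintegral.
  - by bounded_measurable_tac.
  - by bounded_measurable_tac.
  - by apply: filterS fE => z ->.
have eqR : risk P f = risk P (f_Dis eta s b t).
  rewrite !(risk_cost (cell_scaled_refl P))//; apply: ae_eq_bounded_Rintegral.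
  - exact: bounded_measurable_fst (bounded_measurable_cost _ cf).
  - exact: bounded_measurable_fst (bounded_measurable_cost _ cft).
  - by apply: filterS fE => z; rewrite /cost => ->.
split=> // g cg gD; rewrite eqR.
by have := f_Dis_lagrangian t cg; lra.
Qed.

End Regression.
End Cells.

Theorem theorem5p1 (R : realType) (d : measure_display) (T : measurableType d)
  (P : probability (T * bool * bool)%type R)
  (eta : bool -> T -> R) (eta_reg : is_regression P eta)
  (s b : bool -> R) (Dis : (T * bool -> R) -> R)
  (Dis_bilinear : bilinear_disparity P eta s b Dis)
  (eta_pdf : forall a : bool, has_pdf P (fun z => eta a z.1.1))
  (w_pdf : forall a : bool,
     has_pdf P (fun z => dis_weight eta s b (z.1.1, a)))
  (t : R) (t_dom : forall a : bool, 0 < 2 - t * s a)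
  (c : bool -> R) (c_gt0 : forall a : bool, 0 < c a)
  (Pt : probability (T * bool * bool)%type R)
  (Pt_reweighted : reweighted P s b t c Pt)
  (Pt_total : cellp Pt true true + cellp Pt true false
            + cellp Pt false true + cellp Pt false false = 1) :
  (0 <= t * D_Dis eta s b Dis t ->
   forall f : T * bool -> R, bayes_optimal Pt f ->
     fair_bayes_optimal P Dis `|D_Dis eta s b Dis t| f) /\
  (forall delta : R, 0 <= delta -> t_Dis eta s b Dis delta t ->
   forall f : T * bool -> R, bayes_optimal Pt f ->
     fair_bayes_optimal P Dis delta f).
Proof.
have core := bayes_optimal_constrained eta_reg Dis_bilinear eta_pdf t_dom
  c_gt0 Pt_reweighted.
split=> [tD f bf|delta _ tdelta f bf]; have [fD fopt] := core f bf.
- split; [by case: bf|by rewrite fD|move=> g cg gD; apply: fopt => //].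
  (* The sign condition turns [t D(t)] into [|t| |D(t)|], which bounds [t Dis(g)]. *)
  rewrite -[leRHS]ger0_norm// normrM.
  by apply: le_trans (ler_norm _) _; rewrite normrM ler_wpM2l.
- split; [by case: bf|by rewrite fD; case: tdelta|move=> g cg gD; apply: fopt => //].
  exact: (t_Dis_dominates eta_reg Dis_bilinear eta_pdf t_dom tdelta gD).
Qed.
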